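(* Let $n>2$, $\mathbf{A}=\{a_1,\dots,a_n\}$, and let $\mathbf{S}_2^n=\{XY : X,Y\in\mathbf{A}^*\setminus\{\emptyset\},\ \overline{\nu}(X)=\overline{\nu}(Y)\}$. Then $$L_{min}(\mathbf{S}_2^n)=4n-7.$$
   Context: A word over $\mathbf{A}$ is a finite sequence of letters; $\mathbf{A}^*$ is the set of all words. A subword is a block of consecutive letters. For a word $X$, the content vector is $\overline{\nu}(X)=(\nu_1(X),\dots,\nu_n(X))$, where $\nu_i(X)$ is the number of occurrences of $a_i$ in $X$. For $\mathbf{S}\subseteq\mathbf{A}^*$, a word is free from $\mathbf{S}$ if none of its subwords belongs to $\mathbf{S}$. A word $X$ free from $\mathbf{S}$ is crucial with respect to $\mathbf{S}$ if for every letter $a\in\mathbf{A}$ the word $Xa$ contains a subword belonging to $\mathbf{S}$. $L_{min}(\mathbf{S})$ is the smallest length of a crucial word with respect to $\mathbf{S}$. *)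

(* Defs.v *)
From mathcomp Require Import all_boot.
Set Implicit Arguments. Unset Strict Implicit. Unset Printing Implicit Defensive.

Definition word (n : nat) := seq 'I_n.

Definition content (n : nat) (X : word n) : {ffun 'I_n -> nat} :=
  [ffun i => count_mem i X].

Definition abelian_square (n : nat) (w : word n) : Prop :=
  exists X Y : word n, [/\ X != [::], Y != [::], w = X ++ Y & content X = content Y].

Definition free_from (n : nat) (S : word n -> Prop) (w : word n) : Prop :=
  forall u : word n, infix u w -> ~ S u.

Definition crucial (n : nat) (S : word n -> Prop) (w : word n) : Prop :=
  free_from S w /\ forall a : 'I_n, ~ free_from S (rcons w a).

Definition Lmin_is (n : nat) (S : word n -> Prop) (m : nat) : Prop :=
  (exists w : word n, crucial S w /\ size w = m) /\
  (forall w : word n, crucial S w -> m <= size w).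

(* Main.v *)
Require Import Defs.
From mathcomp Require Import all_boot.
From mathcomp Require Import zify ring.

(** If [X] is crucial, then for each letter [i] some suffix of [X] of odd length
    [2 h_i + 1] contains [i] in its left part (of length [h_i + 1]) once more
    than in its right part (of length [h_i]), and every other letter equally
    often.  The [h_i] are distinct; let [N] maximise [h_i] with [H = h_N].  In
    the suffix of length [2 H + 1] each letter other than [N] occurs twice as
    often as among the last [H] letters, hence at least twice.  At most two
    letters occur exactly twice: if [j], [k], [m] did, with
    [h_j < h_k < h_m < H], then [m] would be absent from the suffix of length
    [2 h_k + 1] while [j] would occur twice there, so that this suffix would be
    both shorter and longer than [H].  Hence [2 H + 1 >= 1 + 2*2 + 4 (n - 3)].

    Conversely, over the letters [1, ..., n] the word
      [2 n  3 2 4 3 5 4 ... (n-1)(n-2)  1  2 3 ... (n-1) ... 3 2 1]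
    has length [4n - 7] and is crucial; it is free from abelian squares because
    each of its nonempty subwords contains some letter an odd number of times. *)

(** * Lower bound *)

Lemma count_take_mono (T : eqType) (a : T) (s : seq T) x y : x <= y ->
  count_mem a (take x s) <= count_mem a (take y s).
Proof.
move=> xy; rewrite -(take_takel s xy); apply: leq_count_subseq.
exact: take_subseq.
Qed.

Lemma sum_count_mem (T : finType) (s : seq T) :
  \sum_(a : T) count_mem a s = size s.
Proof.
elim: s => [|x s IHs] /=; first by rewrite big1.
rewrite big_split /= IHs (bigD1 x) //= eqxx big1 ?addn0 // => a ax.
by rewrite eq_sym (negbTE ax).
Qed.

(** Since [w] is free, the abelian square in [rcons w i] is a suffix; deleting its last letter [i]
    leaves halves of lengths [h + 1] and [h]. Suffixes of [w] are read as prefixes of [rev w]. *)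
Lemma crucial_halves (n : nat) (w : word n) (i : 'I_n) :
  crucial (@abelian_square n) w ->
  exists h, [/\ h.*2.+1 <= size w & forall a,
    count_mem a (take h.*2.+1 (rev w)) =
    (count_mem a (take h (rev w))).*2 + (a == i)].
Proof.
case=> free_w /(_ i) sq_wi.
(* Cruciality only denies freeness, so [h] is obtained by deciding a search bounded by [size w]. *)
have [/existsP[h /andP[hw /forallP eqh]]|noh] := boolP [exists h : 'I_(size w),
    (h.*2.+1 <= size w) && [forall a, count_mem a (take h.*2.+1 (rev w)) ==
      (count_mem a (take h (rev w))).*2 + (a == i)]].
  by exists h; split=> // a; apply/eqP.
case: sq_wi => u; rewrite infix_rconsl => /orP[|/free_w //].
case/suffixP=> s + [X [Y [X0 Y0 uE]]].
rewrite {}uE; case/lastP: Y Y0 => // Q j _.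
rewrite -!rcons_cat => /rcons_inj[wE <-] /ffunP eqXY.
have ctXQ a : count_mem a X = count_mem a Q + (a == i).
  by have := eqXY a; rewrite !ffunE -cats1 count_cat /= addn0 (eq_sym i).
have szX : size X = (size Q).+1.
  rewrite -!sum_count_mem (eq_bigr _ (fun a _ => ctXQ a)) big_split /=.
  rewrite -addn1; congr (_ + _).
  by rewrite (bigD1 i) //= eqxx big1 // => a /negbTE->.
have szw : (size Q).*2.+1 <= size w by rewrite wE !size_cat szX; lia.
have hw : size Q < size w by lia.
case/negP: noh; apply/existsP; exists (Ordinal hw); rewrite /= szw.
apply/forallP => a; rewrite wE !rev_cat -catA.
rewrite [take (size Q) _]take_size_cat ?size_rev // catA.
rewrite take_size_cat; last by rewrite size_cat !size_rev szX; lia.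
by rewrite count_cat !count_rev ctXQ addnA addnn.
Qed.

Lemma crucial_size (n : nat) (w : word n) : 0 < n ->
  crucial (@abelian_square n) w -> 4 * n - 7 <= size w.
Proof.
move=> n0 /crucial_halves wP.
have /fin_all_exists[h hP] i := wP i.
pose c (a : 'I_n) x := count_mem a (take x (rev w)).
have cM a x y : x <= y -> c a x <= c a y by apply: count_take_mono.
have cE i a : c a (h i).*2.+1 = (c a (h i)).*2 + (a == i).
  by rewrite /c; have [_ ->] := hP i.
have codd i : 0 < c i (h i).*2.+1 by rewrite cE eqxx addn1.
case: (@arg_maxnP _ (Ordinal n0) predT h isT) => N _ hN.
have {}hN i : h i <= h N by apply: hN.
pose D := [set i | (i != N) && (c i (h N) == 1)].
have cpos i : i != N -> 0 < c i (h N).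
  move=> iN; have := cM i (h i).*2.+1 (h N).*2.+1; have := codd i.
  by have := cE N i; rewrite (negbTE iN); have := hN i; lia.
have key j k m : j \in D -> m \in D -> h j < h k -> h k < h m -> False.
  rewrite !inE => /andP[jN /eqP cj] /andP[mN /eqP cm] jk km.
  have jk' : j != k by apply: contraTneq jk => ->; rewrite ltnn.
  have mk' : m != k by apply: contraTneq km => ->; rewrite ltnn.
  (* By parity: [m] occurs twice in the suffix for [N], so exactly once in the one for [m], where
     its count is odd, and never in the one for [k], where it is even. *)
  have cmm : c m (h k).*2.+1 = 0.
    have := cE N m; have := cE k m; have := cE m m.
    rewrite (negbTE mN) (negbTE mk') eqxx cm.
    have := cM m (h m).*2.+1 (h N).*2.+1; have := cM m (h k).*2.+1 (h m).*2.+1.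
    by have := hN m; lia.
  have cjj : 1 < c j (h k).*2.+1.
    have := codd j; have := cM j (h j).*2.+1 (h k).*2.+1.
    by have := cE k j; rewrite (negbTE jk'); lia.
  (* The last [h N] letters contain [j] and [m] once each: a suffix at least as long contains [m], a
     shorter one contains [j] at most once. *)
  case: (leqP (h N) (h k).*2.+1) => [/(cM m)|/ltnW/(cM j)]; lia.
(* Otherwise one suffix would contain [i] both an odd and an even number of times. *)
have hI : injective h.
  move=> i j hij; have := cE i i; rewrite hij cE eqxx.
  by case: eqP => // _; lia.
have cardD : #|D| <= 2.
  rewrite leqNgt; apply/negP => /card_gt2P[x [y [z [[xD yD zD] [xy yz zx]]]]].
  have neq i j : i != j -> h i != h j by rewrite (inj_eq hI).
  move: (neq _ _ xy) (neq _ _ yz) (neq _ _ zx).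
  case: ltngtP => // hxy _; case: ltngtP => // hyz _; case: ltngtP => // hzx _.
  - lia.
  - exact: (key x y z).
  - exact: (key z x y).
  - exact: (key x z y).
  - exact: (key y z x).
  - exact: (key y x z).
  - exact: (key z y x).
  - lia.
have szw : \sum_a c a (h N).*2.+1 = (h N).*2.+1.
  by rewrite sum_count_mem size_takel // size_rev; have [] := hP N.
(* The counts are even and positive, and equal to 2 only on [D], where the added 2 makes up the
   deficit. *)
have : \sum_(a | a != N) 4 <= \sum_(a | a != N) (c a (h N).*2.+1 + 2 * (a \in D)).
  apply: leq_sum => a aN; rewrite cE (negbTE aN) inE aN /=.
  by have := cpos a aN; case: eqP => /=; lia.
rewrite big_split /= -big_distrr /= sum_nat_const.
have -> : \sum_(a | a != N) (a \in D : nat) = #|D|.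
  rewrite -sum1_card big_mkcond [RHS]big_mkcond; apply: eq_bigr => a _.
  by rewrite inE; case: (a != N) => //=; case: ifP.
have -> : #|[pred a | a != N]| = n.-1.
  by have := cardC1 N; rewrite card_ord => <-; apply: eq_card.
move: szw; rewrite (bigD1 N) //=; have := codd N; have [+ _] := hP N.
move: cardD; move: (c N _) (\sum_(i < n | i != N) _) #|D| => x y z.
by lia.
Qed.

(** * A crucial word of length [4n - 7] *)

Definition odd_infixes {T : eqType} (w : seq T) : Prop :=
  forall u, infix u w -> u != [::] -> exists a, odd (count_mem a u).

Lemma prefix_cat_split (T : eqType) (u s t : seq T) : prefix u (s ++ t) ->
  prefix u s \/ exists2 v, u = s ++ v & prefix v t.
Proof.
elim: s u => [|x s IHs] [|y u].
- by left.
- by right; exists (y :: u).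
- by left.
rewrite cat_cons !prefix_cons => /andP[/eqP-> /IHs[us|[v -> vt]]].
  by left; rewrite eqxx.
by right; exists v.
Qed.

Lemma infix_cat_cons (T : eqType) (u s1 s2 : seq T) x :
  infix u (s1 ++ x :: s2) ->
  [\/ infix u s1, infix u s2 |
      exists v1 v2, [/\ u = v1 ++ x :: v2, suffix v1 s1 & prefix v2 s2]].
Proof.
elim: s1 => [|y s1 IHs].
  rewrite infix_consl => /orP[|]; last by constructor 2.
  case: u => [|z u]; first by constructor 1; rewrite infix0s.
  rewrite prefix_cons => /andP[/eqP-> uP]; constructor 3.
  by exists [::], u; rewrite suffix0s.
rewrite cat_cons infix_consl -cat_cons => /orP[/prefix_cat_split[us|[v ->]]|/IHs[us|us|]].
- by constructor 1; apply: prefixW.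
- case: v => [_|z v]; first by constructor 1; rewrite cats0 infix_refl.
  rewrite prefix_cons => /andP[/eqP-> vs]; constructor 3.
  by exists (y :: s1), v; rewrite suffix_refl.
- by constructor 1; rewrite infix_consl us orbT.
- by constructor 2.
- case=> v1 [v2 [uE v1s v2s]]; constructor 3; exists v1, v2; split=> //.
  by apply: suffix_trans v1s _; apply: suffix_cons.
Qed.

(** A block that covers the middle [x] contains it exactly once. *)
Lemma odd_infixes_cat_cons (T : eqType) (s1 s2 : seq T) x :
  x \notin s1 -> x \notin s2 -> odd_infixes s1 -> odd_infixes s2 ->
  odd_infixes (s1 ++ x :: s2).
Proof.
move=> xs1 xs2 o1 o2 u /infix_cat_cons[/o1//|/o2//|[v1 [v2 [-> v1s v2s]]]] _.
exists x; rewrite count_cat /= eqxx (count_memPn _) ?(count_memPn _) //.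
  by apply: contra xs2; apply: mem_infix; apply: prefixW.
by apply: contra xs1; apply: mem_infix; apply: suffixW.
Qed.

Lemma odd_infixes_uniq (T : eqType) (s : seq T) : uniq s -> odd_infixes s.
Proof.
move=> us [|x u] // uS _; exists x.
by rewrite count_uniq_mem ?mem_head // (infix_uniq uS us).
Qed.

(** The word [a+1, a, a+2, a+1, ..., a+k, a+k-1]. *)
Fixpoint zigzag a k : seq nat :=
  if k is k'.+1 then a.+1 :: a :: zigzag a.+1 k' else [::].

Lemma zigzagD a i j : zigzag a (i + j) = zigzag a i ++ zigzag (a + i) j.
Proof.
elim: i a => [|i IHi] a /=; first by rewrite addn0.
by rewrite IHi addSnnS.
Qed.

Lemma perm_zigzag a k : perm_eq (zigzag a k) (iota a.+1 k ++ iota a k).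
Proof.
elim: k a => [|k IHk] a //; apply/permP=> P.
by rewrite /= (permP (IHk _)) !count_cat /=; lia.
Qed.

Lemma mem_zigzag a k x : (x \in zigzag a k) = (0 < k) && (a <= x <= a + k).
Proof. by rewrite (perm_mem (perm_zigzag a k)) mem_cat !mem_iota; lia. Qed.

Lemma size_zigzag a k : size (zigzag a k) = k.*2.
Proof. by rewrite (perm_size (perm_zigzag a k)) size_cat !size_iota addnn. Qed.

Lemma count_zigzag_lt a k x : x < a -> count_mem x (zigzag a k) = 0.
Proof. by move=> xa; apply/count_memPn; rewrite mem_zigzag; lia. Qed.

(** Take for [b] the second letter of the first pair that [u] meets, whole or cut: all later letters
    are larger. *)
Lemma suffix_zigzag a k u : suffix u (zigzag a k) -> u != [::] ->
  exists2 b, a <= b < a + k & count_mem b u = 1.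
Proof.
elim: k a u => [|k IHk] a u /=; first by rewrite suffixs0 => ->.
case/suffixP=> [[|x [|y p]]] /=.
- move=> <- _; exists a; first by lia.
  by rewrite /= eqxx gtn_eqF // count_zigzag_lt.
- case=> _ <- _; exists a; first by lia.
  by rewrite /= eqxx count_zigzag_lt.
- case=> _ _ E u0; have [|//|b bk ub] := IHk a.+1 u.
    by rewrite E suffix_suffix.
  by exists b => //; lia.
Qed.

(** A block starting in the first pair contains [a] exactly once, unless it is the single letter
    [a + 1]. *)
Lemma odd_infixes_zigzag a k : odd_infixes (zigzag a k).
Proof.
elim: k a => [|k IHk] a u; first by rewrite infixs0 => ->.
rewrite [zigzag _ _]/= !infix_consl => /or3P[||/IHk//]; case: u => // x u.
  rewrite prefix_cons => /andP[/eqP-> {x}]; case: u => [|x u] +  _.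
    by exists a.+1; rewrite /= eqxx.
  rewrite prefix_cons => /andP[/eqP-> /prefixP[t E]]; exists a.
  have := count_zigzag_lt a.+1 k a (ltnSn a); rewrite E count_cat /= eqxx gtn_eqF //.
  by lia.
rewrite prefix_cons => /andP[/eqP-> /prefixP[t E]] _; exists a.
have := count_zigzag_lt a.+1 k a (ltnSn a); rewrite E count_cat /= eqxx.
by lia.
Qed.

(* The letters [1, ..., n] are shifted to [0, ..., n - 1], and [n = m + 3]. *)
Definition short_word m : seq nat :=
  1 :: m.+2 :: zigzag 1 m ++ 0 :: iota 1 m.+1 ++ rev (iota 1 m) ++ [:: 0].

Lemma size_short_word m : size (short_word m) = 4 * m + 5.
Proof.
by rewrite /= size_cat size_zigzag /= !size_cat size_rev !size_iota /=; lia.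
Qed.

Lemma all_short_word m : all (fun x => x < m.+3) (short_word m).
Proof.
apply/allP=> x; rewrite !inE mem_cat mem_zigzag inE !mem_cat mem_rev !mem_iota.
by rewrite inE; lia.
Qed.

Lemma odd_infixes_short_word m : odd_infixes (short_word m).
Proof.
pose T := iota 1 m.+1 ++ rev (iota 1 m).
have oT : odd_infixes T.
  rewrite /T -[m.+1]addn1 iotaD -catA /= add1n.
  by apply: odd_infixes_cat_cons; rewrite ?mem_rev ?mem_iota ?ltnn ?andbF //;
     apply: odd_infixes_uniq; rewrite ?rev_uniq iota_uniq.
have T0 : 0 \notin T by rewrite mem_cat mem_rev !mem_iota.
have Z0 : 0 \notin zigzag 1 m by rewrite mem_zigzag andbF.
have nil_odd : odd_infixes (@nil nat) by apply: odd_infixes_uniq.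
(* Split at [m + 2], which occurs only once. *)
have -> : short_word m =
    [:: 1] ++ m.+2 :: (zigzag 1 m ++ 0 :: T ++ [:: 0]).
  by rewrite /short_word /T -catA.
apply: odd_infixes_cat_cons; rewrite ?inE //.
- by rewrite !(mem_cat, inE) mem_zigzag mem_rev !mem_iota; lia.
- exact: odd_infixes_uniq.
have oZ := odd_infixes_zigzag 1 m.
have oT0 : odd_infixes (T ++ [:: 0]) by apply: odd_infixes_cat_cons.
move=> u /infix_cat_cons[/oZ//|/oT0//|].
case=> v1 [v2 [-> v1Z v2T]] _.
have v10 : 0 \notin v1 by apply: contra Z0; apply/mem_infix/suffixW.
case/prefix_cat_split: v2T => [v2T|[v -> vP]].
  exists 0; rewrite count_cat /= (count_memPn _) ?(count_memPn _) //.
  by apply: contra T0; apply/mem_infix/prefixW.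
move: vP; rewrite prefixs1 => /orP[]/eqP-> {v}.
  exists 0; rewrite cats0 count_cat (count_memPn v10) -[0 :: T]cat1s count_cat.
  by rewrite (count_memPn T0).
(* Now the block contains both zeros. If it starts at the first one, [m + 1] occurs once; otherwise
   some [b] with [1 <= b <= m] occurs once before it and twice in [T]. *)
have [v1E|v1N] := eqVneq v1 [::].
  exists m.+1; rewrite v1E /= !count_cat count_rev !count_uniq_mem ?iota_uniq //.
  by rewrite !mem_iota /=; lia.
have [b bm cb] := suffix_zigzag 1 m v1 v1Z v1N.
exists b; rewrite count_cat /= !count_cat cb count_rev !count_uniq_mem ?iota_uniq //.
by rewrite !mem_iota inE /=; lia.
Qed.

Lemma short_word_square m k : k < m.+3 -> exists s X Y,
  [/\ X != [::], rcons (short_word m) k = s ++ X ++ Y & perm_eq X Y].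
Proof.
pose D := rev (iota 0 m.+1).
have wE : short_word m = 1 :: m.+2 :: zigzag 1 m ++ iota 0 m.+2 ++ D.
  by rewrite /D /short_word [in RHS]/= rev_cons -cats1.
rewrite ltnS leq_eqVlt => /orP[/eqP->|km].
  (* For the letter [m + 2] the whole extended word is a square, cut after the first 0. *)
  exists [::], (1 :: m.+2 :: zigzag 1 m ++ [:: 0]), (iota 1 m.+1 ++ D ++ [:: m.+2]).
  split=> //; first by rewrite wE /= -cats1 -!catA /= -!catA.
  apply/permP=> P; rewrite /= !count_cat /D count_rev /= addn0.
  by rewrite (permP (perm_zigzag 1 m)) count_cat; ring.
case: k km => [_|k km].
  exists (1 :: m.+2 :: zigzag 1 m ++ 0 :: iota 1 m.+1 ++ rev (iota 1 m)).
  exists [:: 0], [:: 0]; split=> //.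
  by rewrite /short_word /= -cats1 -!catA /= -!catA.
(* For the letter [k + 1] the square starts inside the zigzag, after its first [k] pairs, and its
   left half ends at the first [k + 1] after the first 0. *)
have [j mE] : exists j, m = k + j by exists (m - k); lia.
exists (1 :: m.+2 :: zigzag 1 k), (zigzag k.+1 j ++ iota 0 k.+2).
exists (iota k.+2 j ++ D ++ [:: k.+1]); split.
- by case: (zigzag _ _).
- rewrite wE mE zigzagD add1n -addSn -addSn iotaD -cats1.
  by rewrite add0n /= -!catA /= -!catA.
apply/permP=> P; rewrite !count_cat /D count_rev mE.
rewrite (permP (perm_zigzag k.+1 j)) count_cat.
rewrite -addSn iotaD -[k.+2]addn1 iotaD !count_cat add0n /=.
by lia.
Qed.

Lemma odd_infixes_free n (w : word n) :
  odd_infixes w -> free_from (@abelian_square n) w.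
Proof.
move=> ow u uw [X [Y [X0 _ uE /ffunP XY]]]; have [||a] := ow u => //.
  by rewrite uE; case: (X) X0.
by have := XY a; rewrite uE !ffunE count_cat => ->; rewrite addnn odd_double.
Qed.

Lemma odd_infixes_map (T S : eqType) (f : T -> S) (w : seq T) : injective f ->
  odd_infixes (map f w) -> odd_infixes w.
Proof.
move=> fI ow u /infixP[p [q wE]] u0.
have [||b ob] := ow (map f u).
- by rewrite wE !map_cat infix_infix.
- by case: (u) u0.
have : b \in map f u by rewrite -has_pred1 has_count; case: count ob.
case/mapP=> a _ bE; exists a; move: ob; rewrite bE count_map.
by congr (odd _); apply: eq_count => x /=; rewrite (inj_eq fI).
Qed.

Lemma crucial_short_word m : exists2 w : word m.+3,
  crucial (@abelian_square m.+3) w & size w = 4 * m + 5.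
Proof.
(* All letters are below [m + 3], so [inord] never falls back on its default. *)
pose w := map inord (short_word m) : word m.+3.
have valw : map val w = short_word m.
  rewrite -map_comp map_id_in // => x /(allP (all_short_word m)) xm.
  by rewrite /= inordK.
exists w; last by rewrite size_map size_short_word.
split.
  apply: odd_infixes_free; apply: (odd_infixes_map _ _ val _ val_inj).
  by rewrite valw; apply: odd_infixes_short_word.
move=> a; have [s [X [Y [X0 E /permP XY]]]] := short_word_square m a (ltn_ord a).
move/(_ (map inord X ++ map inord Y)); apply.
  apply: suffixW; apply/suffixP; exists (map inord s).
  by rewrite -!map_cat -E map_rcons inord_val.
exists (map inord X), (map inord Y); split=> //.
- by case: (X) X0.
- have : size Y != 0 by rewrite -(count_predT Y) -XY count_predT; case: (X) X0.
  by case: (Y).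
- by apply/ffunP=> b; rewrite !ffunE !count_map XY.
Qed.

Theorem theorem2 (n : nat) (hn : 2 < n) :
  Lmin_is (@abelian_square n) (4 * n - 7).
Proof.
split; last by move=> w; apply: crucial_size; lia.
case: n hn => [|[|[|m]]] // _; have [w cw sw] := crucial_short_word m.
by exists w; rewrite sw; split=> //; lia.
Qed.
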